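(* Let $M$ be a metric space with $\operatorname{dens} M\leq 2^{\omega}$. Then $(\operatorname{Lip}_0(M),\tau_p)$ is separable.
   Context: $M$ has a distinguished base point $0$. $\operatorname{Lip}_0(M)$ is the space of real-valued Lipschitz functions $f$ on $M$ with $f(0)=0$, and $\tau_p$ is the topology of pointwise convergence on $M$. $\operatorname{dens}$ is the smallest cardinality of a dense subset; $2^\omega$ is the cardinality of the continuum. *)

(* Defs.v *)
From mathcomp Require Import all_boot all_order all_algebra.
From mathcomp Require Import all_classical all_reals all_analysis.

Set Implicit Arguments.
Unset Strict Implicit.
Unset Printing Implicit Defensive.

Import Order.TTheory GRing.Theory Num.Theory.
Import numFieldNormedType.Exports.

Local Open Scope classical_set_scope.
Local Open Scope card_scope.
Local Open Scope ring_scope.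

(* Cardinals are compared through sets: the smallest cardinality of a dense
   subset is carried by a chosen dense subset that injects into every dense
   subset; [densP] shows that there is one. *)
Definition dens (T : topologicalType) : set T :=
  get [set D : set T | dense D /\ forall E : set T, dense E -> D #<= E].
Arguments dens T : clear implicits.

Lemma card_le_min (T : Type) (F : set (set T)) : F !=set0 ->
  exists2 D, F D & forall E, F E -> D #<= E.
Proof.
move=> [D0 FD0].
(* S is a set of choice functions on F that pairwise differ everywhere; if S is
   maximal then evaluation at some D in F maps S onto D. *)
pose ok (S : set (set T -> T)) :=
  (forall s E, S s -> F E -> E (s E)) /\
  (forall s t E, S s -> S t -> F E -> s E = t E -> s = t).
have [S [[Sin Sinj] Smax]] : exists S, ok S /\ forall B, S `<` B -> ~ ok B.
  apply: Zorn_bigcup => C Cok Ctot; split=> [s E [S CS Ss]|s t E].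
    by have [+ _] := Cok _ CS; apply.
  move=> [A CA As] [B CB Bt]; have [/(_ _ As) Bs|/(_ _ Bt) At] := Ctot A B CA CB.
    by have [_] := Cok _ CB; apply.
  by have [_] := Cok _ CA; apply.
have [[D FD DS]|nsurj] :=
    pselect (exists2 D, F D & forall x, D x -> exists2 s, S s & s D = x).
  exists D => // E FE.
  have /card_le_trans : D #<= S.
    have DE : D `<=` (fun s : set T -> T => s D) @` S.
      by move=> x /DS[s Ss <-]; exists s.
    exact: card_le_trans (subset_card_le DE) (card_image_le _ _).
  apply.
  have inj : {in S &, injective (fun s : set T -> T => s E)}.
    by move=> s t /set_mem Ss /set_mem St; exact: Sinj.
  rewrite -(card_le_eql (inj_card_eq inj)).
  by apply: subset_card_le => _ [s Ss <-]; exact: (Sin s E Ss FE).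
have miss E : F E -> exists x, E x /\ forall s, S s -> s E <> x.
  move=> FE; apply: contrapT => nx; apply: nsurj; exists E => // x Ex.
  apply: contrapT => ns; apply: nx; exists x; split=> // s Ss sx.
  by apply: ns; exists s.
have [x0 _] := miss D0 FD0.
have /choice[f fP] E : exists x, F E -> E x /\ forall s, S s -> s E <> x.
  by have [/miss[x ?]|nFE] := pselect (F E); [exists x | exists x0].
have nSf : ~ S f by move=> Sf; have [_ /(_ f Sf)] := fP D0 FD0; apply.
exfalso; apply: (Smax (S `|` [set f])).
  by split; [exact: subsetUl | move=> /(_ f (or_intror erefl))].
split=> [s E [Ss|->] FE|s t E [Ss|->] [St|->] FE st //].
- exact: (Sin s E Ss FE).
- by have [] := fP E FE.
- exact: (Sinj s t E Ss St FE st).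
- by have [_ /(_ s Ss)] := fP E FE; rewrite st.
- by have [_ /(_ t St)] := fP E FE; rewrite st.
Qed.

Lemma densP (T : topologicalType) :
  dense (dens T) /\ forall E : set T, dense E -> dens T #<= E.
Proof.
have [|D dD Dmin] := @card_le_min T (@dense T).
  by exists setT => O [x Ox] _; exists x.
exact: (@getPex _ [set D : set T | dense D /\ forall E : set T, dense E -> D #<= E]
  (ex_intro _ D (conj dD Dmin))).
Qed.

Definition separable_space (T : topologicalType) : Prop :=
  exists2 D : set T, countable D & dense D.

Definition Lip0 (R : realType) (M : metricType R) (o : M) :
    set {ptws M -> R} :=
  [set f | f o = 0 /\
    exists L : R, forall x y : M, `|f x - f y| <= L * mdist x y].

(* The subspace topology induced on Lip0 by pointwise convergence. *)
Definition Lip0_ptws (R : realType) (M : metricType R) (o : M) :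
    topologicalType :=
  initial_topology (val : Lip0 o -> {ptws M -> R}).

(* Main.v *)
(* Suppose that countably many bounded Lipschitz functions h are such that any
   ordered pair of distinct points (x, y) has some h with h x = 0 and h y = 1.
   Products of the h then give, for every finite set of points, bumps equal to 1
   at one of them and to 0 at the others, so the rational combinations of such
   products that vanish at the base point are pointwise dense in Lip0 and
   countable in number.
   To find the h, code the points of a dense set A by sequences of bits. For a
   radius r, well-ordering A refines the cover by the r-balls around A into a
   partition whose pieces, shrunk by a margin 1/n, are pairwise at distance at
   least 1/n. Hence the truncated distance to the union of the shrunk pieces
   whose code has m-th bit 1 is Lipschitz, is 0 on this union and 1 on the other
   shrunk pieces; r, n and m range over countable sets. *)
Require Import Defs.
From mathcomp Require Import all_boot all_order all_algebra.
From mathcomp Require Import all_classical all_reals all_analysis.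
From mathcomp Require wochoice.
From mathcomp Require Import lra.

Set Implicit Arguments.
Unset Strict Implicit.
Unset Printing Implicit Defensive.

Import Order.TTheory GRing.Theory Num.Theory.
Import numFieldNormedType.Exports.

Local Open Scope classical_set_scope.
Local Open Scope ring_scope.

(** The sets [U] with this property form a filter. The topology is a supremum over the points of
    [M], so this filter converges to [f] once it does so at each single point, where a one-element
    [s] suffices. *)
Lemma nbhs_ptws (R : realType) (M : eqType) (f : {ptws M -> R})
    (U : set {ptws M -> R}) : nbhs f U ->
  exists (s : seq M) (e : R), 0 < e /\
    forall g : M -> R, (forall x, x \in s -> `|f x - g x| < e) -> U g.
Proof.
pose F : set_system {ptws M -> R} := [set U | exists (s : seq M) (e : R),
  0 < e /\ forall g : M -> R, (forall x, x \in s -> `|f x - g x| < e) -> U g].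
have FF : Filter F.
  split=> [|P Q [s [e [e0 sP]]] [t [d [d0 tQ]]]|P Q PQ [s [e [e0 sP]]]].
  - by exists nil, 1; split.
  - exists (s ++ t), (Num.min e d); split=> [|g stg]; first by rewrite lt_min e0.
    split; [apply: sP|apply: tQ] => x xs.
      have : `|f x - g x| < Num.min e d by apply: stg; rewrite mem_cat xs.
      by rewrite lt_min => /andP[].
    have : `|f x - g x| < Num.min e d by apply: stg; rewrite mem_cat xs orbT.
    by rewrite lt_min => /andP[].
  - by exists s, e; split=> // g /sP/PQ.
suff : F --> f by move=> /(_ U).
apply/cvg_sup => i V [_ [[W oW <-] Wf WV]].
have /nbhs_ballP[e e0 eW] : nbhs (f i) W by exact: open_nbhs_nbhs.
exists [:: i], e; split=> // g fg; apply/WV/eW.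
by rewrite /ball /=; apply: fg; rewrite mem_head.
Qed.

(** * Stability of bounded Lipschitz functions, and truncated distances *)

Section BoundedLipschitz.
Context (R : realType) (M : metricType R).
Implicit Types f g : M -> R.

(** Boundedness is what makes the class stable under products; a single constant serves for both
    bounds. *)
Definition bounded_lipschitz f := exists C : R,
  (forall x, `|f x| <= C) /\ forall x y, `|f x - f y| <= C * mdist x y.

Lemma bounded_lipschitz_cst (c : R) : bounded_lipschitz (fun=> c).
Proof.
exists `|c|; split=> // x y.
by rewrite subrr normr0 mulr_ge0 ?mdist_ge0.
Qed.

Lemma bounded_lipschitzD f g : bounded_lipschitz f -> bounded_lipschitz g ->
  bounded_lipschitz (fun x => f x + g x).
Proof.
move=> [C [fC Cf]] [D [gD Dg]]; exists (C + D); split=> [x|x y].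
  apply: le_trans (ler_normD _ _) _. exact: lerD.
rewrite opprD addrACA mulrDl.
by apply: le_trans (ler_normD _ _) _; exact: lerD.
Qed.

Lemma bounded_lipschitzM f g : bounded_lipschitz f -> bounded_lipschitz g ->
  bounded_lipschitz (fun x => f x * g x).
Proof.
move=> [C [fC Cf]] [D [gD Dg]]; exists (C * D + C * D); split=> [x|x y].
  rewrite normrM; apply: (@le_trans _ _ (C * D)); first by rewrite ler_pM.
  by rewrite lerDl mulr_ge0 ?(le_trans _ (fC x)) ?(le_trans _ (gD x)).
have -> : f x * g x - f y * g y = f x * (g x - g y) + (f x - f y) * g y.
  by rewrite mulrBr mulrBl addrA subrK.
rewrite [leRHS]mulrDl; apply: le_trans (ler_normD _ _) _.
apply: lerD; rewrite normrM.
  by rewrite -mulrA ler_pM.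
by rewrite mulrAC ler_pM.
Qed.

Lemma bounded_lipschitz_sum (J : Type) (s : seq J) (F : J -> M -> R) :
  (forall j, bounded_lipschitz (F j)) ->
  bounded_lipschitz (fun x => \sum_(j <- s) F j x).
Proof.
move=> HF; elim: s => [|j s IH].
  by under eq_fun do rewrite big_nil; exact: bounded_lipschitz_cst.
by under eq_fun do rewrite big_cons; exact: bounded_lipschitzD.
Qed.

Lemma bounded_lipschitz_prod (J : Type) (s : seq J) (F : J -> M -> R) :
  (forall j, bounded_lipschitz (F j)) ->
  bounded_lipschitz (fun x => \prod_(j <- s) F j x).
Proof.
move=> HF; elim: s => [|j s IH].
  by under eq_fun do rewrite big_nil; exact: bounded_lipschitz_cst.
by under eq_fun do rewrite big_cons; exact: bounded_lipschitzM.
Qed.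

(* This is [min (1, k * d(x, Z))]; adding 1 to the set makes the value 1, and
   not the junk infimum 0, when Z is empty. *)
Definition trunc_dist (k : R) (Z : set M) (x : M) : R :=
  inf ([set 1] `|` [set k * mdist x z | z in Z]).

Section TruncDist.
Variables (k : R) (Z : set M).
Hypothesis k0 : 0 <= k.

Let lb0 x : lbound ([set 1] `|` [set k * mdist x z | z in Z]) 0.
Proof. by move=> _ [->|[z _ <-]] //; rewrite mulr_ge0 ?mdist_ge0. Qed.

Lemma trunc_dist_ge0 x : 0 <= trunc_dist k Z x.
Proof. by apply: lb_le_inf; [exists 1; left | exact: lb0]. Qed.

Lemma trunc_dist_le x z : Z z -> trunc_dist k Z x <= k * mdist x z.
Proof. by move=> Zz; apply: ge_inf; [exists 0; exact: lb0 | right; exists z]. Qed.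

Lemma trunc_dist_le1 x : trunc_dist k Z x <= 1.
Proof. by apply: ge_inf; [exists 0; exact: lb0 | left]. Qed.

Lemma trunc_dist_eq0 x : Z x -> trunc_dist k Z x = 0.
Proof.
move=> Zx; apply/eqP; rewrite eq_le trunc_dist_ge0 andbT.
by rewrite (le_trans (trunc_dist_le x Zx)) // mdistxx mulr0.
Qed.

Lemma trunc_dist_eq1 x :
  (forall z, Z z -> 1 <= k * mdist x z) -> trunc_dist k Z x = 1.
Proof.
move=> kZ; apply/eqP; rewrite eq_le trunc_dist_le1 /=.
by apply: lb_le_inf => [|_ [->|[z /kZ ? <-]]] //; exists 1; left.
Qed.

Lemma bounded_lipschitz_trunc_dist : bounded_lipschitz (trunc_dist k Z).
Proof.
have lip x y : trunc_dist k Z x - trunc_dist k Z y <= k * mdist x y.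
  rewrite lerBlDl -lerBlDr; apply: lb_le_inf; first by exists 1; left.
  move=> _ [->|[z Zz <-]].
    by rewrite lerBlDr (le_trans (trunc_dist_le1 x)) // lerDl mulr_ge0 ?mdist_ge0.
  rewrite lerBlDr (le_trans (trunc_dist_le x Zz)) // -mulrDr ler_wpM2l //.
  by rewrite addrC metric_triangle.
(* The constant has to dominate both the bound 1 on the values and the slope [k]. *)
exists (1 + k); split=> [x|x y].
  by rewrite ger0_norm ?trunc_dist_ge0 // (le_trans (trunc_dist_le1 x)) // lerDl.
rewrite (@le_trans _ _ (k * mdist x y)) //.
  by rewrite ler_norml lip andbT lerNl opprB metric_sym lip.
by rewrite ler_wpM2r ?mdist_ge0 // lerDr.
Qed.

End TruncDist.
End BoundedLipschitz.

(** * Density of rational combinations, given a countable separating family *)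

Section Interpolation.
Context (R : realType) (M : metricType R) (o : M).
Context (I : countType) (i0 : I) (h : I -> M -> R).
Hypothesis h_bl : forall i, bounded_lipschitz (h i).
Hypothesis h_sep : forall x y, x <> y -> exists i, h i x = 0 /\ h i y = 1.

(** The combinations are indexed by finite expressions, which form a [countType]; countability of
    the family is then immediate. *)
Definition rat_comb (t : seq (rat * seq I)) (x : M) : R :=
  \sum_(p <- t) ratr p.1 * \prod_(i <- p.2) h i x.

Lemma bounded_lipschitz_rat_comb t : bounded_lipschitz (rat_comb t).
Proof.
apply: bounded_lipschitz_sum => p; apply: bounded_lipschitzM.
  exact: bounded_lipschitz_cst.
exact: bounded_lipschitz_prod.
Qed.

(** This is Lagrange interpolation: the bump at [z] is the product, over the other nodes [y], of a
    function that is 0 at [y] and 1 at [z]. Counting [o] among the nodes makes every bump vanish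
    there. *)
Lemma rat_comb_interpolate (s : seq M) (q : M -> rat) : uniq s ->
  o \notin s ->
  exists t, rat_comb t o = 0 /\ forall x, x \in s -> rat_comb t x = ratr (q x).
Proof.
move=> us os.
have /choice[k kP] (yz : M * M) :
    exists i, yz.1 <> yz.2 -> h i yz.1 = 0 /\ h i yz.2 = 1.
  have [->|/eqP/h_sep[i iP]] := eqVneq yz.1 yz.2; last by exists i.
  by exists i0.
pose t := [seq (q z, [seq k (y, z) | y <- o :: s & y != z]) | z <- s].
have tE x : rat_comb t x =
    \sum_(z <- s) ratr (q z) * \prod_(y <- o :: s | y != z) h (k (y, z)) x.
  rewrite /rat_comb big_map; apply: eq_bigr => z _.
  by congr (_ * _); rewrite -[RHS]big_filter; exact: big_map.
have prod0 x z : x \in o :: s -> x != z ->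
    \prod_(y <- o :: s | y != z) h (k (y, z)) x = 0.
  move=> xs xz; rewrite (big_rem x xs) /= xz.
  by have [-> _] := kP (x, z) (elimN eqP xz); rewrite mul0r.
exists t; split=> [|x xs]; rewrite tE.
  rewrite big_seq big1 // => z zs; rewrite prod0 ?mulr0 ?mem_head //.
  by apply: contraNneq os => ->.
rewrite (bigD1_seq x) //= [X in _ + X]big1 ?addr0 => [|z zx]; last first.
  by rewrite prod0 ?mulr0 // 1?eq_sym // inE xs orbT.
rewrite big1 ?mulr1 // => y yx.
by have [_ ->] := kP (y, x) (elimN eqP yx).
Qed.

Lemma separable_Lip0_ptws : separable_space (Lip0_ptws o).
Proof.
pose D := [set f : Lip0_ptws o | exists t, val f = rat_comb t].
exists D.
  have /choice[t tP] (f : Lip0_ptws o) : exists t, D f -> val f = rat_comb t.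
    by have [[t ft]|nDf] := pselect (D f); [exists t | exists nil].
  apply/countable_injP; exists (pickle \o t) => f g /set_mem Df /set_mem Dg.
  move=> /(pcan_inj pickleK) tfg; apply: val_inj.
  by rewrite (tP f Df) (tP g Dg) tfg.
move=> O [f Of] [U oU UO]; move: Of; rewrite -UO /= => Uf.
have [s [e [e0 sU]]] := nbhs_ptws (open_nbhs_nbhs (conj oU Uf)).
have [fo _] := set_valP f.
have /choice[q qP] x : exists q, `|val f x - ratr q| < e.
  have [|q] := @rat_in_itvoo _ (val f x - e) (val f x + e).
    by rewrite ltrD2l gtrN.
  by rewrite in_itv /= => qe; exists q; rewrite distrC ltr_distl.
(* The base point is removed since both functions vanish there; its approximation [q o] need not be
   0. *)
pose s' := undup [seq x <- s | x != o].
have [||t [to tq]] := @rat_comb_interpolate s' q; first exact: undup_uniq.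
  by rewrite mem_undup mem_filter eqxx.
have tL : Lip0 o (rat_comb t).
  by split=> //; have [C [_ ?]] := bounded_lipschitz_rat_comb t; exists C.
exists (SigSub (mem_set tL) : Lip0_ptws o); split; last by exists t.
apply: sU => x xs /=; have [->|xo] := eqVneq x o.
  by rewrite to fo subrr normr0.
by rewrite tq ?qP // mem_undup mem_filter xo.
Qed.

End Interpolation.

(** * Construction of the countable separating family *)

Section SeparatingFamily.
Context (R : realType) (M : metricType R).

(* Stone's trick: send z to the first point of A, in a well-order of M, within
   distance r of z. If z and y are sent to different points, then the earlier of
   these two points is at distance at least r from z or from y. *)
Lemma discrete_refinement (A : set M) (r : R) : dense A -> 0 < r ->
  exists a : M -> M, forall z, [/\ A (a z), mdist z (a z) < r &
    forall y, a z <> a y -> r <= mdist z (a y) \/ r <= mdist y (a z)].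
Proof.
move=> dA r0; have [W Wwo] := wochoice.well_ordering_principle M.
have Wanti :=
  wochoice.wo_chain_antisymmetric (wochoice.withinW (A := predT) Wwo).
have /choice[a aP] (z : M) : exists p, (A p /\ mdist z p < r) /\
    forall q, A q -> mdist z q < r -> W p q.
  have [|p [pB pmin]] := dA (ball z r)° _ (@open_interior _ _).
    by exists z; exact: nbhsx_ballx.
  have {}pB := interior_subset pB.
  have [|u [[]]] := Wwo [pred p | `[<A p /\ mdist z p < r>]].
    exists p; apply/asboolT; split=> //.
    by move: pB; rewrite ballEmdist.
  move=> /asboolP uP umin _; exists u; split=> // q Aq zq.
  by apply: umin; apply/asboolT.
exists a => z; have [[Az zr] zmin] := aP z; split=> // y zy.
(* If both distances were below [r], each of [a z] and [a y] would compete in the choice of the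
   other, and minimality both ways would make them equal. *)
have [[Ay yr] ymin] := aP y.
have [?|yzr] := leP r (mdist z (a y)); first by left.
have [?|zyr] := leP r (mdist y (a z)); first by right.
by case: zy; apply: Wanti => //; rewrite zmin // ymin.
Qed.

Lemma separating_family (A : set M) (c : M -> nat -> bool) :
  dense A -> {in A &, injective c} ->
  exists h : nat * nat * nat * bool -> M -> R,
    (forall i, bounded_lipschitz (h i)) /\
    forall x y, x <> y -> exists i, h i x = 0 /\ h i y = 1.
Proof.
move=> dA c_inj; pose r i : R := i.+1%:R^-1.
have r0 i : 0 < r i by rewrite invr_gt0.
have /choice[a aP] i := discrete_refinement dA (r0 i).
(* Points of [Z i n m] and points with the same margin [1 / n.+1] whose code has
   m-th bit 0 are at distance at least [1 / n.+1]. *)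
pose Z i n m := [set z | c (a i z) m /\ mdist z (a i z) + n.+1%:R^-1 <= r i].
pose td i n m := trunc_dist n.+1%:R (Z i n m).
have td_bl i n m : bounded_lipschitz (td i n m).
  exact: bounded_lipschitz_trunc_dist.
(* The last index allows the values 0 and 1 to be exchanged, since the pairs to be separated are
   ordered. *)
pose h (j : nat * nat * nat * bool) x : R :=
  let: (i, n, m, b) := j in if b then td i n m x else 1 + -1 * td i n m x.
exists h; split=> [[[[i n] m] []] /=|x y xy]; first exact: td_bl.
  apply: bounded_lipschitzD; first exact: bounded_lipschitz_cst.
  by apply: bounded_lipschitzM; first exact: bounded_lipschitz_cst.
(* With [r i] below half the distance, no centre is within [r i] of both [x] and [y]. The index [n]
   is then taken so large that both points survive the shrinking. *)
have [|i] := @ltr_add_invr R 0 (mdist x y / 2).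
  by rewrite divr_gt0 // mdist_gt0; exact/eqP.
rewrite add0r -/(r i) => rxy.
have [Ax xr _] := aP i x; have [Ay yr _] := aP i y.
have [n] := @ltr_add_invr R (Num.max (mdist x (a i x)) (mdist y (a i y))) (r i)
  ltac:(by rewrite gt_max xr).
rewrite -ltrBrDr gt_max !ltrBrDr => /andP[/ltW xn /ltW yn].
have axy : a i x <> a i y.
  move=> axy; have := metric_triangle x (a i x) y.
  by rewrite [X in _ + X]metric_sym {2}axy; lra.
have [m cm] : exists m, c (a i x) m != c (a i y) m.
  apply: contrapT => nm; apply: axy; apply: c_inj; try exact: mem_set.
  by apply/funext => m; apply: contrapT => /eqP cm; apply: nm; exists m.
have key u v : mdist u (a i u) + n.+1%:R^-1 <= r i ->
    mdist v (a i v) + n.+1%:R^-1 <= r i -> c (a i u) m -> ~~ c (a i v) m ->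
    td i n m u = 0 /\ td i n m v = 1.
  have shift (p q s t e : R) : p <= q -> q <= s + t -> t + e <= p -> e <= s.
    by lra.
  move=> un vn cu cv; split; first by apply: trunc_dist_eq0.
  apply: trunc_dist_eq1 => // z [cz zn].
  rewrite mulrC -ler_pdivrMr // mul1r.
  (* The bit [m] rules out a common centre. Either [z] is far from the centre of [v] or the reverse,
     so the margin is required of both points; the triangle inequality then leaves at least
     [1 / n.+1] between them. *)
  have [_ _ /(_ v)[|zv|vz]] := aP i z.
  - by move=> azv; move: cv; rewrite -azv cz.
  - by apply: shift zv _ vn; rewrite [mdist v z]metric_sym metric_triangle.
  - by apply: shift vz _ zn; exact: metric_triangle.
case cx: (c (a i x) m) cm => cm.
  by exists (i, n, m, true); apply: key; rewrite ?cx //; case: (c _ _) cm.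
(* Here the bit is 0 at [x] and 1 at [y], so [key] applies to the reversed pair. *)
exists (i, n, m, false) => /=.
have [||||-> ->] := key y x; rewrite ?cx //; first by case: (c _ _) cm.
by split; lra.
Qed.

End SeparatingFamily.

Local Open Scope card_scope.

Theorem theorem9 (R : realType) (M : metricType R) (o : M)
    (densM : dens M #<= [set: nat -> bool]%classic) :
  separable_space (Lip0_ptws o).
Proof.
have [dA _] := densP M; have /pcard_leTP[c] := densM.
have [h [h_bl h_sep]] := separating_family dA (@inj _ _ _ c).
exact: (separable_Lip0_ptws o (0, 0, 0, true)%N h_bl h_sep).
Qed.
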